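(* There is a polynomial-time algorithm that, for any mixed fair division instance $([n],[m],\mathcal{V})$ with symmetric tri-valued (not necessarily normalized) additive valuations, i.e. $v_i(o)\in\{-1,0,1\}$ for every agent $i$ and item $o$, finds a (complete) allocation that is both EQ1 and Pareto optimal (PO), whenever such an allocation exists.
   Context: A (mixed) fair division instance $([n],[m],\mathcal{V})$ consists of $n$ agents, a set $O=[m]$ of $m$ indivisible items, and valuations $\mathcal{V}=\{v_1,\dots,v_n\}$ with $v_i:2^{[m]}\to\mathbb{Z}$ additive: $v_i(S)=\sum_{o\in S}v_i(o)$. A (complete) allocation $A=(A_1,\dots,A_n)$ is a partition of the set of all items into $n$ (possibly empty) bundles, $A_i$ going to agent $i$. An instance is normalized if $v_i(O)$ is the same constant for all agents $i$. An allocation $A$ is EQ1 (equitable up to one item) if for every pair of agents $i,j$ with $v_i(A_i)<v_j(A_j)$, either there exists $g\in A_j$ with $v_j(g)\ge 0$ such that $v_i(A_i)\ge v_j(A_j\setminus\{g\})$, or there exists $c\in A_i$ with $v_i(c)\le 0$ such that $v_i(A_i\setminus\{c\})\ge v_j(A_j)$. An allocation $A$ is Pareto optimal (PO) if there is no allocation $A'$ with $v_i(A'_i)\ge v_i(A_i)$ for all agents $i$ and $v_j(A'_j)>v_j(A_j)$ for at least one agent $j$. *)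

(* Defs.v *)
From HB Require Import structures.
From mathcomp Require Import all_boot all_order all_algebra.
Set Implicit Arguments. Unset Strict Implicit. Unset Printing Implicit Defensive.
Import Order.TTheory GRing.Theory Num.Theory.
Local Open Scope ring_scope.

Section FairDivision.
Variables n m : nat.

(* Additive valuations are given by their values on single items: [v i o] is
   agent i's value for item o. *)
Definition valuations := 'I_n -> 'I_m -> int.

Definition bundle_value (v : valuations) (i : 'I_n) (S : {set 'I_m}) : int :=
  \sum_(o in S) v i o.

Definition bundles := 'I_n -> {set 'I_m}.

Definition allocation (A : bundles) : Prop :=
  (forall i j, i != j -> [disjoint A i & A j]) /\
  \bigcup_(i : 'I_n) A i = [set: 'I_m].

Definition EQ1 (v : valuations) (A : bundles) : Prop :=
  forall i j, bundle_value v i (A i) < bundle_value v j (A j) ->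
    (exists g, [/\ g \in A j, 0 <= v j g &
       bundle_value v j (A j :\ g) <= bundle_value v i (A i)]) \/
    (exists c, [/\ c \in A i, v i c <= 0 &
       bundle_value v j (A j) <= bundle_value v i (A i :\ c)]).

Definition PO (v : valuations) (A : bundles) : Prop :=
  ~ exists A' : bundles,
      [/\ allocation A',
          forall i, bundle_value v i (A i) <= bundle_value v i (A' i) &
          exists j, bundle_value v j (A j) < bundle_value v j (A' j)].

Definition symmetric_trivalued (v : valuations) : Prop :=
  forall i o, [\/ v i o = -1, v i o = 0 | v i o = 1].

End FairDivision.

(* The model of computation is a unit-cost random access machine over the
   integers, programmed with structured control flow.  The memory consists of
   integer arrays [a], each indexed by all integers, of which a program uses
   only finitely many; a scalar variable is a cell of an array.  The only
   arithmetic is addition and subtraction: with no multiplication, the bit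
   length of the stored numbers grows at most linearly in the number of steps,
   so that polynomial time here agrees with polynomial time on a Turing
   machine. *)
Definition memory := nat -> int -> int.

Definition write (s : memory) (a : nat) (k x : int) : memory :=
  fun b l => if (b == a) && (l == k) then x else s b l.

Inductive expr :=
  | Const of int
  | Read of nat & expr
  | Add of expr & expr
  | Sub of expr & expr.

Fixpoint eval (s : memory) (e : expr) : int :=
  match e with
  | Const x => x
  | Read a e1 => s a (eval s e1)
  | Add e1 e2 => eval s e1 + eval s e2
  | Sub e1 e2 => eval s e1 - eval s e2
  end.

(* The guard of [If e1 e2] and of [While e1 e2] is the test e1 <= e2, and
   [Write a e1 e2] stores the value of e2 in cell e1 of array a. *)
Inductive program :=
  | Skip
  | Write of nat & expr & expr
  | Seq of program & program
  | If of expr & expr & program & program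
  | While of expr & expr & program.

(* [exec c s s' t]: started in memory s, program c halts in memory s' after t
   steps.  A step is one skip, write or test.  The expressions occurring in a
   program have a fixed size, so counting each operation inside them would
   change t by at most a constant factor depending on c only. *)
Inductive exec : program -> memory -> memory -> nat -> Prop :=
  | exec_skip s : exec Skip s s 1
  | exec_write s a e1 e2 :
      exec (Write a e1 e2) s (write s a (eval s e1) (eval s e2)) 1
  | exec_seq c1 c2 s s1 s2 t1 t2 :
      exec c1 s s1 t1 -> exec c2 s1 s2 t2 ->
      exec (Seq c1 c2) s s2 (t1 + t2)%N
  | exec_if_true e1 e2 c1 c2 s s' t :
      eval s e1 <= eval s e2 -> exec c1 s s' t ->
      exec (If e1 e2 c1 c2) s s' t.+1
  | exec_if_false e1 e2 c1 c2 s s' t :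
      eval s e2 < eval s e1 -> exec c2 s s' t ->
      exec (If e1 e2 c1 c2) s s' t.+1
  | exec_while_true e1 e2 c s s1 s2 t1 t2 :
      eval s e1 <= eval s e2 -> exec c s s1 t1 ->
      exec (While e1 e2 c) s1 s2 t2 ->
      exec (While e1 e2 c) s s2 (t1 + t2).+1%N
  | exec_while_false e1 e2 c s :
      eval s e2 < eval s e1 -> exec (While e1 e2 c) s s 1.

Lemma exec_deterministic c s s1 s2 t1 t2 :
  exec c s s1 t1 -> exec c s s2 t2 -> s1 = s2 /\ t1 = t2.
Proof.
move=> H; elim: H s2 t2 => {c s s1 t1}.
- by move=> s s2 t2 H; inversion H.
- by move=> s a e1 e2 s2 t2 H; inversion H.
- move=> c1 c2 s s1 s' t1 t' _ IH1 _ IH2 s2 t2 H.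
  inversion H as [| |? ? ? r ? u1 u2 E1 E2| | | |]; subst.
  by have [? ?] := IH1 _ _ E1; subst; have [-> ->] := IH2 _ _ E2.
- move=> e1 e2 c1 c2 s s' t le12 _ IH s2 t2 H.
  inversion H as [| | |? ? ? ? ? ? u L E|? ? ? ? ? ? u L E| |]; subst.
    by have [-> ->] := IH _ _ E.
  by rewrite ltNge le12 in L.
- move=> e1 e2 c1 c2 s s' t lt21 _ IH s2 t2 H.
  inversion H as [| | |? ? ? ? ? ? u L E|? ? ? ? ? ? u L E| |]; subst.
    by rewrite ltNge L in lt21.
  by have [-> ->] := IH _ _ E.
- move=> e1 e2 c s s1 s' t1 t' le12 _ IH1 _ IH2 s2 t2 H.
  inversion H as [| | | | |? ? ? ? r ? u1 u2 L E1 E2|? ? ? ? L]; subst.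
    by have [? ?] := IH1 _ _ E1; subst; have [-> ->] := IH2 _ _ E2.
  by rewrite ltNge le12 in L.
- move=> e1 e2 c s lt21 s2 t2 H.
  inversion H as [| | | | |? ? ? ? r ? u1 u2 L E1 E2|? ? ? ? L]; subst => //.
  by rewrite ltNge L in lt21.
Qed.

(* Array 0 holds n in cell 0 and m in cell 1; array 1 holds the n x m table of
   values in row-major order, v i o being in cell i * m + o.  All other cells
   are 0. *)
Definition input_memory n m (v : valuations n m) : memory := fun a k =>
  match a, k with
  | 0%N, Posz 0 => n%:Z
  | 0%N, Posz 1 => m%:Z
  | 1%N, Posz l =>
      \sum_(i < n) \sum_(o < m) (if l == (i * m + o)%N then v i o else 0)
  | _, _ => 0
  end.

Lemma input_memory_table n m (v : valuations n m) (i : 'I_n) (o : 'I_m) :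
  input_memory v 1%N ((i * m + o)%N)%:Z = v i o.
Proof.
rewrite /= (bigD1 i) //= (bigD1 o) //= eqxx big1 ?addr0; last first.
  by move=> o' ne; rewrite eqn_add2l ifN // eq_sym.
rewrite big1 ?addr0 // => i' ne; apply: big1 => o' _; rewrite ifN //.
have m0 : (0 < m)%N by case: (m) o => [[]|].
apply: contra ne => /eqP E; apply/eqP/val_inj => /=.
by have := congr1 (divn^~ m) E; rewrite !divnMDl // !divn_small // !addn0.
Qed.

(* The answer is read off array 2, whose cell o holds the index of the agent
   who receives item o. *)
Definition output n m (s : memory) : bundles n m :=
  fun i => [set o : 'I_m | s 2%N (nat_of_ord o)%:Z == (nat_of_ord i)%:Z].

Arguments output n m s i : clear implicits.

(* Main.v *)
(* An allocation is Pareto optimal iff every item goes to an agent valuing it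
   most, and such an allocation is EQ1 iff all utilities lie in some {k, k + 1}.
   Starting from any maximal assignment, a phase with threshold t works as in
   the push-relabel method: an agent of utility at least t + 2 passes one unit
   of utility (gives away a good or takes over a chore) to an agent whose label
   is one less, and raises its own label if it cannot.  Labels never drop by
   more than one along a possible transfer and stay at most n, so at the end of
   the phase some level is skipped and the agents above it form a set that no
   unit of utility can leave.  Every maximal assignment gives this set at least
   as much utility; so if some maximal assignment has utilities in {k, k + 1},
   the phases t < k raise the minimal utility to k, the phase t = k lowers the
   maximal one to k + 1, and later phases change nothing. *)
Require Import Defs.
From HB Require Import structures.
From mathcomp Require Import all_boot all_order all_algebra.
From mathcomp Require Import zify.
Import Order.TTheory GRing.Theory Num.Theory.
Set Implicit Arguments. Unset Strict Implicit. Unset Printing Implicit Defensive.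
Local Open Scope ring_scope.

(** * Maximal assignments, transfers of utility and closed sets *)

Section Assignments.
Variables (n m : nat) (v : valuations n m).
Hypothesis v3 : symmetric_trivalued v.
Implicit Types (f g : 'I_m -> 'I_n) (S : {set 'I_n}) (A : bundles n m).

Definition utility f a : int := \sum_(o | f o == a) v a o.

Definition maximal f := forall a o, v a o <= v (f o) o.

Definition reassign f o b : 'I_m -> 'I_n := fun o' => if o' == o then b else f o'.

(* Reassigning item o, of value 1 or -1 for both agents, can move one unit of
   utility from a to b: a good leaves a, or a chore leaves b. *)
Definition transfer f a b o : bool :=
  (v a o == v b o) &&
  ((v a o == 1) && (f o == a) || (v a o == -1) && (f o == b)).

Definition closed f S :=
  forall a b o, a \in S -> b \notin S -> ~~ transfer f a b o.

Definition owner f A := forall a o, (o \in A a) = (f o == a).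

Lemma value_bounds a o : -1 <= v a o <= 1.
Proof. by case: (v3 a o) => ->. Qed.

Lemma maximal_eq f g o : maximal f -> maximal g -> v (f o) o = v (g o) o.
Proof. by move=> mf mg; apply/eqP; rewrite eq_le mf mg. Qed.

Lemma utility_bounds f a : - m%:Z <= utility f a <= m%:Z.
Proof.
suff: `|utility f a| <= m%:Z by rewrite ler_norml.
rewrite /utility big_mkcond; apply: le_trans (ler_norm_sum _ _ _) _.
apply: (@le_trans _ _ (\sum_(o < m) 1)).
  by apply: ler_sum => o _; case: ifP => // _; rewrite ler_norml value_bounds.
by rewrite sumr_const card_ord -natz.
Qed.

Lemma utility_reassign f o b a : f o != b ->
  utility (reassign f o b) a =
    utility f a - (if a == f o then v a o else 0) + (if a == b then v a o else 0).
Proof.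
move=> nb; rewrite /utility big_mkcond (bigD1 o) //= [in RHS]big_mkcond.
rewrite [in RHS](bigD1 o) //= /reassign eqxx !(eq_sym a).
rewrite [in LHS](eq_bigr (fun o' => if f o' == a then v a o' else 0)); last first.
  by move=> o' /negbTE ->.
by rewrite [X in X - _]addrC addrK addrC.
Qed.

Lemma sum_utility f S :
  \sum_(a in S) utility f a = \sum_o if f o \in S then v (f o) o else 0.
Proof.
rewrite (exchange_big_dep xpredT) //=; apply: eq_bigr => o _.
case: ifP => fS.
  rewrite (big_pred1 (f o)) // => a /=.
  by rewrite (eq_sym (f o)); case: eqP => [->|]; rewrite ?fS ?andbF.
by rewrite big_pred0 // => a; case: eqP => [<-|]; rewrite ?fS ?andbF.
Qed.

(** By maximality every item has the same value under [f] and [g]. Passing from [f] to [g], a good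
    leaving [S] or a chore entering [S] would be a transfer out of [S], so the items that leave have
    value at most 0 and those that enter have value at least 0. *)
Lemma closed_sum_le f g S : maximal f -> maximal g -> closed f S ->
  \sum_(a in S) utility f a <= \sum_(a in S) utility g a.
Proof.
move=> mf mg cl; rewrite !sum_utility; apply: ler_sum => o _.
rewrite -(maximal_eq o mf mg).
case fS: (f o \in S); case gS: (g o \in S) => //.
- have := cl _ _ o fS (negbT gS).
  rewrite /transfer (maximal_eq o mf mg) !eqxx /= andbT negb_or.
  by case: (v3 (g o) o) => -> //; rewrite andbF.
- have := cl _ _ o gS (negbT fS).
  rewrite /transfer (maximal_eq o mf mg) !eqxx /= andbT negb_or.
  by case: (v3 (g o) o) => -> //; rewrite andbF.
Qed.

(** All maximal assignments have the same total, so the complement loses what [S] gains. *)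
Lemma closed_setC_sum_le f g S : maximal f -> maximal g -> closed f S ->
  \sum_(a in ~: S) utility g a <= \sum_(a in ~: S) utility f a.
Proof.
move=> mf mg cl; have := closed_sum_le mf mg cl.
have E k : \sum_(a in S) utility k a + \sum_(a in ~: S) utility k a
         = \sum_o v (k o) o.
  rewrite !sum_utility -big_split /=; apply: eq_bigr => o _.
  by rewrite inE; case: (k o \in S) => /=; rewrite ?addr0 ?add0r.
have: \sum_o v (f o) o = \sum_o v (g o) o.
  by apply: eq_bigr => o _; apply: maximal_eq.
rewrite -!E; lia.
Qed.

(** The differences [F a - G a] are nonnegative and their sum is at most 0, so all vanish. *)
Lemma sum_tight (T : finType) (S : {set T}) (F G : T -> int) (c : int) :
  \sum_(a in S) F a <= \sum_(a in S) G a ->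
  (forall a, a \in S -> c <= F a) -> (forall a, a \in S -> G a <= c) ->
  forall a, a \in S -> F a = c /\ G a = c.
Proof.
move=> le FS GS a aS.
have d0 b : b \in S -> 0 <= F b - G b.
  by move=> bS; rewrite subr_ge0 (le_trans (GS b bS)) ?FS.
have sum0: \sum_(b in S) (F b - G b) = 0.
  by apply: le_anti; rewrite sumr_ge0 // andbT sumrB subr_le0.
have := psumr_eq0P d0 sum0 aS; have := FS a aS; have := GS a aS; lia.
Qed.

(** * Pareto optimality and EQ1 in terms of assignments *)

Lemma owner_bundle_value f A a : owner f A -> bundle_value v a (A a) = utility f a.
Proof. by move=> fA; apply: eq_bigl => o; rewrite fA. Qed.

Lemma allocation_owner A : allocation A -> exists f, owner f A.
Proof.
case=> dA cA.
have /fin_all_exists [f fP] : forall o, exists a, o \in A a.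
  move=> o; have: o \in \bigcup_(a : 'I_n) A a by rewrite cA inE.
  by case/bigcupP => a _ oa; exists a.
exists f => a o; apply/idP/eqP => [oa|<- //].
apply/eqP; apply: contraT => ne.
by have /pred0P/(_ o) := dA _ _ ne; rewrite /= fP oa.
Qed.

Lemma owner_allocation f A : owner f A -> allocation A.
Proof.
move=> fA; split=> [a b ne|].
  by apply/pred0P => o /=; rewrite !fA; case: eqP => // ->; apply: negbTE.
by apply/setP => o; rewrite inE; apply/bigcupP; exists (f o); rewrite ?fA.
Qed.

(** With only three values, an agent [a] valuing [o] more than its holder values it at 0 or 1, and
    the holder values it at 0 or -1. Handing [o] to [a] then hurts nobody and helps at least one of
    the two. *)
Lemma PO_maximal f A : owner f A -> PO v A -> maximal f.
Proof.
move=> fA po a o; rewrite leNgt; apply/negP => lt; apply: po.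
have ne : f o != a by apply: contraTneq lt => ->; rewrite ltxx.
pose A' b := [set o' | reassign f o a o' == b].
have fA' : owner (reassign f o a) A' by move=> b o'; rewrite inE.
exists A'; split; first exact: owner_allocation fA'.
- move=> b; rewrite (owner_bundle_value _ fA) (owner_bundle_value _ fA').
  rewrite utility_reassign //.
  have [->|_] := eqVneq b (f o); last have [->|_] := eqVneq b a.
  + rewrite (negbTE ne); case: (v3 a o) (v3 (f o) o) lt => -> [] -> //; lia.
  + case: (v3 a o) (v3 (f o) o) lt => -> [] -> //; lia.
  + lia.
- case: (v3 a o) (v3 (f o) o) lt => Ea [] Ef; rewrite Ea Ef // => _.
  + exists (f o); rewrite (owner_bundle_value _ fA) (owner_bundle_value _ fA').
    rewrite utility_reassign // eqxx (negbTE ne) Ef; lia.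
  + exists (f o); rewrite (owner_bundle_value _ fA) (owner_bundle_value _ fA').
    rewrite utility_reassign // eqxx (negbTE ne) Ef; lia.
  + exists a; rewrite (owner_bundle_value _ fA) (owner_bundle_value _ fA').
    rewrite utility_reassign // eqxx eq_sym (negbTE ne) Ea; lia.
Qed.

(** A maximal assignment has the largest total utility, which a Pareto improvement would exceed. *)
Lemma maximal_PO f A : owner f A -> maximal f -> PO v A.
Proof.
move=> fA mf [A' [/allocation_owner [g gA'] le [b lt]]].
have: \sum_(a in [set: 'I_n]) utility g a <= \sum_(a in [set: 'I_n]) utility f a.
  rewrite !sum_utility; apply: ler_sum => o _; rewrite !inE; exact: mf.
apply/negP; rewrite -ltNge !(bigD1 b (in_setT b)) /=.
apply: ltr_leD => [|]; last apply: ler_sum => a _.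
  by rewrite -(owner_bundle_value _ fA) -(owner_bundle_value _ gA').
by rewrite -(owner_bundle_value _ fA) -(owner_bundle_value _ gA').
Qed.

Lemma bundle_value_rem a o (S : {set 'I_m}) : o \in S ->
  bundle_value v a (S :\ o) = bundle_value v a S - v a o.
Proof.
by move=> oS; rewrite /bundle_value [in RHS](big_setD1 o) //= addrAC subrr add0r.
Qed.

Lemma EQ1_utility f A : owner f A -> EQ1 v A ->
  forall a b, utility f b <= utility f a + 1.
Proof.
move=> fA eq a b; rewrite -!(owner_bundle_value _ fA).
have [le|lt] := leP (bundle_value v b (A b)) (bundle_value v a (A a)); first lia.
case: (eq _ _ lt) => [[o [oA _]]|[o [oA _]]]; rewrite bundle_value_rem //.
  by have := value_bounds b o; lia.
by have := value_bounds a o; lia.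
Qed.

(** If the richer agent has positive utility, it holds a good that can be removed; otherwise the
    poorer one has negative utility and holds a chore that can be removed. *)
Lemma utility_EQ1 f A : owner f A ->
  (forall a b, utility f b <= utility f a + 1) -> EQ1 v A.
Proof.
move=> fA ub a b; have := ub a b; rewrite -!(owner_bundle_value _ fA) => le lt.
have [pos|npos] := ltP 0 (bundle_value v b (A b)).
  have [/existsP[o /andP[oA vo]]|] := boolP [exists o, (o \in A b) && (0 < v b o)].
    left; exists o; rewrite bundle_value_rem //; split=> //; first exact: ltW.
    by lia.
  rewrite negb_exists => /forallP no; suff: bundle_value v b (A b) <= 0 by lia.
  by apply: sumr_le0 => o oA; move: (no o); rewrite oA /= -leNgt.
have [/existsP[o /andP[oA vo]]|] := boolP [exists o, (o \in A a) && (v a o < 0)].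
  right; exists o; rewrite bundle_value_rem //; split=> //; first exact: ltW.
  by lia.
rewrite negb_exists => /forallP no; suff: 0 <= bundle_value v a (A a) by lia.
by apply: sumr_ge0 => o oA; move: (no o); rewrite oA /= -leNgt.
Qed.

Definition balanced k f := forall a, k <= utility f a <= k + 1.

Definition feasible k := exists2 g, maximal g & balanced k g.

Lemma EQ1_PO_feasible A : (0 < n)%N -> allocation A -> EQ1 v A -> PO v A ->
  exists k, feasible k.
Proof.
move=> n0 /allocation_owner[f fA] /(EQ1_utility fA) eq /(PO_maximal fA) mf.
pose a := [arg min_(a < Ordinal n0) utility f a]%O.
exists (utility f a), f => // b; rewrite eq andbT /a.
by case: Order.TotalTheory.arg_minP => // c _ ->.
Qed.

Lemma balanced_EQ1_PO k f A : owner f A -> maximal f -> balanced k f ->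
  [/\ allocation A, EQ1 v A & PO v A].
Proof.
move=> fA mf bal; split; [exact: owner_allocation fA| |exact: maximal_PO mf].
by apply: (utility_EQ1 fA) => a b; have := bal a; have := bal b; lia.
Qed.

(** * Labels, potential and the invariant of a phase *)

Implicit Types (h : 'I_n -> nat) (t k : int).

Definition valid f h := forall a b o, transfer f a b o -> (h a <= (h b).+1)%N.

Definition raise h a : 'I_n -> nat := fun b => if b == a then (h a).+1 else h b.

Definition admissible f h a b o := (h a == (h b).+1) && transfer f a b o.

Definition receiver a b o := if v a o == 1 then b else a.

Definition push f a b o := reassign f o (receiver a b o).

Definition item_potential f h o : nat :=
  if v (f o) o == 1 then h (f o) else (n - h (f o))%N.

(* Transferring o lowers its item potential by one, because the label drops by
   one along an admissible transfer of a good and rises by one along that of a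
   chore; the factor m.+1 pays for the rise of the item potentials when a label
   is raised. *)
Definition potential f h : nat :=
  (\sum_o item_potential f h o + m.+1 * \sum_a (n - h a))%N.

Lemma potential_bound f h : (forall a, (h a <= n)%N) ->
  (potential f h <= m * n + m.+1 * (n * n))%N.
Proof.
move=> hn; rewrite leq_add // ?leq_mul2l /=.
  rewrite -[m in (m * n)%N]card_ord -sum_nat_const; apply: leq_sum => o _.
  by rewrite /item_potential; case: ifP; rewrite ?leq_subr.
rewrite -[n in (n * _)%N]card_ord -sum_nat_const.
by apply: leq_sum => a _; apply: leq_subr.
Qed.

Lemma potential_raise f h a : (h a < n)%N ->
  (potential f (raise h a) < potential f h)%N.
Proof.
move=> ha.
have items: (\sum_o item_potential f (raise h a) o <= \sum_o item_potential f h o + m)%N.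
  rewrite -[X in (_ <= _ + X)%N](card_ord m) -sum1_card -big_split /=.
  apply: leq_sum => o _.
  by rewrite /item_potential /raise; case: ifP => _; case: eqP => [->|_]; lia.
have labels: (\sum_b (n - raise h a b) + 1 = \sum_b (n - h b))%N.
  rewrite (bigD1 a) //= [RHS](bigD1 a) //= {1}/raise eqxx.
  rewrite (eq_bigr (fun b => n - h b)%N) => [|b]; first by lia.
  by rewrite /raise => /negbTE ->.
by rewrite /potential -labels; lia.
Qed.

Lemma admissible_neq f h a b o : admissible f h a b o -> a != b.
Proof. by case/andP => /eqP E _; apply: contra_eq_neq E => ->; lia. Qed.

Lemma potential_push f h a b o : admissible f h a b o -> (forall c, (h c <= n)%N) ->
  (potential (push f a b o) h < potential f h)%N.
Proof.
move=> adm hn; have ne := admissible_neq adm; case/andP: adm => /eqP hab tr.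
rewrite /potential ltn_add2r (bigD1 o) //= [X in (_ < X)%N](bigD1 o) //=.
rewrite [in X in (X < _)%N](eq_bigr (item_potential f h)).
  rewrite ltn_add2r /item_potential /push /reassign eqxx /receiver.
  case/andP: tr => /eqP vab; case/orP=> /andP[/eqP va /eqP fo].
    by rewrite fo va eqxx -vab va eqxx; lia.
  by rewrite fo -vab va /= va /=; have := hn a; lia.
by move=> o' /negbTE no; rewrite /item_potential /push /reassign no.
Qed.

Lemma utility_push f a b o c : transfer f a b o -> a != b ->
  utility (push f a b o) c = utility f c - (c == a)%:Z + (c == b)%:Z.
Proof.
case/andP => /eqP vab good_or_chore ne.
have nba : b != a by rewrite eq_sym.
case/orP: good_or_chore => /andP[/eqP va /eqP fo].
  rewrite /push /receiver va eqxx utility_reassign ?fo //.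
  have [->|nca] := eqVneq c a; first by rewrite (negbTE ne) va; lia.
  by have [->|ncb] := eqVneq c b; rewrite -?vab ?va; lia.
rewrite /push /receiver va utility_reassign ?fo //.
have [->|nca] := eqVneq c a; first by rewrite (negbTE ne) va; lia.
by have [->|ncb] := eqVneq c b; rewrite -?vab ?va; lia.
Qed.

Lemma maximal_push f a b o : maximal f -> transfer f a b o -> maximal (push f a b o).
Proof.
move=> mf /andP[/eqP vab ga] c o'; rewrite /push /reassign.
case: (eqVneq o' o) => [->|_]; last exact: mf.
have ->: v (receiver a b o) o = v (f o) o; last exact: mf.
rewrite /receiver; case/orP: ga => /andP[/eqP va /eqP ->].
  by rewrite va eqxx -vab.
by rewrite va /= -vab.
Qed.

(** Only transfers of [o] change. A new one starts at [b] if [o] is a good and ends at [a] if it is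
    a chore; before the push the same item could go from [a], respectively to [b], and the label of
    [a] being one above that of [b] turns the old bound into the new one. *)
Lemma valid_push f h a b o : maximal f -> valid f h -> admissible f h a b o ->
  valid (push f a b o) h.
Proof.
move=> mf vf adm; have ne := admissible_neq adm.
case/andP: adm => /eqP hab /andP[/eqP vab ga] x y o'.
rewrite /push /transfer /reassign.
have [->|no] := eqVneq o' o; last by move=> tr; apply: (vf x y o'); exact: tr.
move=> tr; move: ga tr; rewrite /receiver => /orP[]/andP[/eqP va /eqP fo]; rewrite va /=.
  case/andP => /eqP vxy; case/orP=> /andP[/eqP vx /eqP E].
    have := vf a y o; rewrite /transfer va fo -vxy vx !eqxx /= -E hab => /(_ isT); lia.
  by move: va; rewrite vab E -vxy vx.
case/andP => /eqP vxy; case/orP=> /andP[/eqP vx /eqP E].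
  by have := mf x o; rewrite fo -vab vx va.
have := vf x b o; rewrite /transfer fo vx -vab va /= -E hab eqxx => /(_ isT); lia.
Qed.

(** Without admissible transfers, no transfer out of [a] lowers the label at all, which leaves room
    for one unit. *)
Lemma valid_raise f h a : valid f h ->
  (forall b o, ~~ admissible f h a b o) -> valid f (raise h a).
Proof.
move=> vf no x y o tr; have := vf _ _ _ tr; rewrite /raise.
case: (x =P a) tr => [->|_] tr; case: (y =P a) => [->|_]; try lia.
by have := no y o; rewrite /admissible tr andbT; lia.
Qed.

(* What is known, before the phase of threshold t, about every bound k that a
   balanced maximal assignment can attain. *)
Definition bracketed t f := forall k, feasible k ->
  (t <= k -> forall a, t <= utility f a) /\ (k < t -> balanced k f).

(** [phase_positive] persists because labels are raised, and units taken, only at agents of utility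
    at least [t + 2]. *)
Record phase_invariant t f h : Prop := PhaseInvariant {
  phase_maximal : maximal f;
  phase_bracketed : bracketed t f;
  phase_valid : valid f h;
  phase_label : forall a, (h a <= n)%N;
  phase_positive : forall a, (0 < h a)%N -> t + 1 <= utility f a }.

Definition active t f h a := (t + 1 < utility f a) && (h a < n)%N.

Lemma phase_start t f : maximal f -> bracketed t f -> phase_invariant t f (fun=> 0%N).
Proof. by move=> mf bf; split. Qed.

Lemma phase_raise t f h a : phase_invariant t f h -> active t f h a ->
  (forall b o, ~~ admissible f h a b o) -> phase_invariant t f (raise h a).
Proof.
case=> mf bf vf hn hpos /andP[ta ha] no; split=> //.
- exact: valid_raise.
- by move=> b; rewrite /raise; case: eqP.
- by move=> b; rewrite /raise; case: eqP => [-> _|_ /hpos //]; lia.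
Qed.

Lemma phase_push t f h a b o : phase_invariant t f h -> active t f h a ->
  admissible f h a b o -> phase_invariant t (push f a b o) h.
Proof.
case=> mf bf vf hn hpos /andP[ta ha] adm; have ne := admissible_neq adm.
have tr : transfer f a b o by case/andP: adm.
split=> //; [exact: maximal_push| |exact: valid_push|].
- move=> k /bf[lo hi]; split=> [tk c|kt].
    have := lo tk c; rewrite utility_push //.
    by have [->|_] := eqVneq c a; lia.
  (* For [k < t] no push can occur: balance caps the utility of [a] at [k + 1], hence at [t]. *)
  by have /andP[_] := hi kt a; lia.
- move=> c /hpos; rewrite utility_push //.
  by have [->|_] := eqVneq c a; lia.
Qed.

(* The n labels miss one of the n + 1 levels; the agents above that level form
   a closed set. *)
Lemma label_gap h : (forall a, (h a <= n)%N) ->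
  exists2 l, (l <= n)%N & forall a, h a != l.
Proof.
move=> hn; pose H a : 'I_n.+1 := inord (h a).
have [l gap] : exists l, l \notin codom H.
  apply/existsP; rewrite -negb_forall; apply/negP => /forallP all.
  have: (#|[pred l in codom H]| < n.+1)%N.
    by rewrite ltnS (leq_trans (leq_image_card _ _)) // card_ord.
  by rewrite -[X in (_ < X)%N]card_ord ltnNge => /negP[]; apply/subset_leq_card/subsetP.
exists l; first by rewrite -ltnS.
move=> a; apply: contraNneq gap => E; apply/codomP; exists a.
by apply: val_inj; rewrite /= inordK // ltnS.
Qed.

(** Let [S] be closed, with utilities at least [t + 1] inside and at most [t + 1] outside. If
    [t < k], a balanced [g] has utilities at least [t + 1] outside [S] but no larger sum there,
    which forces equality. If [k = t], it has utilities at most [t + 1] inside [S] but no smaller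
    sum there, which again forces equality. *)
Lemma phase_end t f h : phase_invariant t f h ->
  (forall a, ~~ active t f h a) -> bracketed (t + 1) f.
Proof.
case=> mf bf vf hn hpos noact k fk.
have [lo hi] := bf k fk; case: fk => g mg bg.
have [S [clS upS loS]] : exists S, [/\ closed f S,
    forall a, a \in S -> t + 1 <= utility f a &
    forall a, a \notin S -> utility f a <= t + 1].
  (* If nobody exceeds [t + 1], the empty set serves as [S]. *)
  have [/existsP[a0 ta0]|] := boolP [exists a, t + 1 < utility f a]; last first.
    rewrite negb_exists => /forallP none; exists set0; split=> [a b o|a|a _].
    - by rewrite inE.
    - by rewrite inE.
    - by rewrite leNgt none.
  have [l ln gap] := label_gap hn.
  (* The inactive agent [a0] has label [n], so the gap is lower. Agents below the gap thus have
     labels less than [n] and are inactive by their utility. *)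
  have {}ln : (l < n)%N.
    have := noact a0; rewrite /active ta0 /= -leqNgt => na0.
    by rewrite ltn_neqAle ln andbT; have := gap a0; have := hn a0; lia.
  exists [set a | l < h a]%N; split=> [a b o|a|a]; rewrite !inE.
  (* A transfer across the empty level [l] would lower the label by at least two. *)
  - move=> la lb; apply/negP => /vf; have := gap b; lia.
  - by move=> la; apply: hpos; lia.
  - move=> la; have := noact a; rewrite /active negb_and -leNgt -leqNgt.
    by case/orP => //; lia.
have above : t < k -> forall a, t + 1 <= utility f a.
  move=> tk a; have [aS|aS] := boolP (a \in S); first exact: upS.
  have gt b : b \in ~: S -> t + 1 <= utility g b by have := bg b; lia.
  have ft b : b \in ~: S -> utility f b <= t + 1 by rewrite inE; apply: loS.
  have aC : a \in ~: S by rewrite inE.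
  by have [_ ->] := sum_tight (closed_setC_sum_le mf mg clS) gt ft aC.
split=> [tk a|kt]; first by apply: above; lia.
have [kt'|kt'] := ltP k t; first exact: hi.
have {kt'} {}kt : k = t by lia.
subst k => a; rewrite lo //=.
have [aS|aS] := boolP (a \in S); last exact: loS.
have gt b : b \in S -> utility g b <= t + 1 by have := bg b; lia.
by have [-> _] := sum_tight (closed_sum_le mf mg clS) upS gt aS.
Qed.

(** Utilities are at least [-m], so the lower bound holds for every [f], and a feasible [k]
    satisfies [k + 1 >= -m], so the case [k < t] is empty. *)
Lemma bracketed_start f : (0 < n)%N -> bracketed (- m%:Z - 1) f.
Proof.
move=> n0 k [g _ bg]; split=> [_ a|].
  by have := utility_bounds f a; lia.
by have := bg (Ordinal n0); have := utility_bounds g (Ordinal n0); lia.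
Qed.

Lemma bracketed_balanced k f : (0 < n)%N -> bracketed (m%:Z + 1) f -> feasible k ->
  balanced k f.
Proof.
move=> n0 bf fk; have [_] := bf k fk; apply; case: fk => g _ bg.
by have := bg (Ordinal n0); have := utility_bounds g (Ordinal n0); lia.
Qed.

End Assignments.

(** * Execution and running time of loop-free programs and of loops *)

Fixpoint loop_free (c : program) : bool :=
  match c with
  | Skip | Write _ _ _ => true
  | Seq c1 c2 | If _ _ c1 c2 => loop_free c1 && loop_free c2
  | While _ _ _ => false
  end.

(** The default branch also covers [While], so the result is meaningful for loop-free programs
    only. *)
Fixpoint run (c : program) (s : memory) : memory :=
  match c with
  | Write a e1 e2 => write s a (eval s e1) (eval s e2)
  | Seq c1 c2 => run c2 (run c1 s)
  | If e1 e2 c1 c2 => if eval s e1 <= eval s e2 then run c1 s else run c2 s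
  | _ => s
  end.

(** Adding up both branches of a test gives a time bound independent of the memory. *)
Fixpoint cost (c : program) : nat :=
  match c with
  | Seq c1 c2 => cost c1 + cost c2
  | If _ _ c1 c2 => (cost c1 + cost c2).+1
  | _ => 1
  end.

Lemma exec_run c s : loop_free c ->
  exists2 t, exec c s (run c s) t & (t <= cost c)%N.
Proof.
elim: c s => [|a e1 e2|c1 IH1 c2 IH2|e1 e2 c1 IH1 c2 IH2|//] s /=.
- by exists 1%N => //; constructor.
- by exists 1%N => //; constructor.
- case/andP=> /IH1 => /(_ s)[t1 x1 le1] /IH2 => /(_ (run c1 s))[t2 x2 le2].
  by exists (t1 + t2)%N; [econstructor; eassumption|rewrite leq_add].
case/andP=> /IH1 => /(_ s)[t1 x1 le1] /IH2 => /(_ s)[t2 x2 le2].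
case: leP => cmp.
  by exists t1.+1; [constructor|rewrite ltnS (leq_trans le1) ?leq_addr].
by exists t2.+1; [apply: exec_if_false|rewrite ltnS (leq_trans le2) ?leq_addl].
Qed.

Lemma run_If e1 e2 c1 c2 s :
  run (If e1 e2 c1 c2) s = if eval s e1 <= eval s e2 then run c1 s else run c2 s.
Proof. by []. Qed.

Lemma run_Skip s : run Skip s = s.
Proof. by []. Qed.

Lemma run_Seq c1 c2 s : run (Seq c1 c2) s = run c2 (run c1 s).
Proof. by []. Qed.

Lemma run_Write a e1 e2 s :
  run (Write a e1 e2) s = write s a (eval s e1) (eval s e2).
Proof. by []. Qed.

Arguments run : simpl never.

(* The ghost state x records what the memory s encodes. *)
Lemma exec_while (X : Type) (I : X -> memory -> Prop) (mu : X -> nat) e1 e2 c T :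
  (forall x s, I x s -> eval s e1 <= eval s e2 ->
     exists y s' t, [/\ exec c s s' t, (t <= T)%N, I y s' & (mu y < mu x)%N]) ->
  forall x s, I x s -> exists y s' t,
    [/\ exec (While e1 e2 c) s s' t, (t <= mu x * T.+1 + 1)%N, I y s' &
        eval s' e2 < eval s' e1].
Proof.
move=> step x; have [k] := ubnP (mu x); elim: k x => // k IH x; rewrite ltnS => muk s Ix.
have [le|lt] := leP (eval s e1) (eval s e2); last first.
  by exists x, s, 1%N; split=> //; [apply: exec_while_false|rewrite addn1].
have [y [s1 [t1 [x1 le1 Iy lty]]]] := step x s Ix le.
have [|z [s2 [t2 [x2 le2 Iz gt]]]] := IH y _ s1 Iy; first exact: leq_trans lty muk.
exists z, s2, (t1 + t2).+1; split=> //; first by econstructor; eassumption.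
have: ((mu y).+1 * T.+1 <= mu x * T.+1)%N by rewrite leq_mul2r lty orbT.
by rewrite mulSn; lia.
Qed.

Lemma exec_while_run (X : Type) (I : X -> memory -> Prop) (mu : X -> nat) e1 e2 c :
  loop_free c ->
  (forall x s, I x s -> eval s e1 <= eval s e2 ->
     exists2 y, I y (run c s) & (mu y < mu x)%N) ->
  forall x s, I x s -> exists y s' t,
    [/\ exec (While e1 e2 c) s s' t, (t <= mu x * (cost c).+1 + 1)%N, I y s' &
        eval s' e2 < eval s' e1].
Proof.
move=> lf step; apply: exec_while => x s Ix le.
have [y Iy lt] := step x s Ix le; have [t xt tc] := exec_run s lf.
by exists y, (run c s), t.
Qed.

(* The balancing program *)
Declare Scope program_scope.
Delimit Scope program_scope with prog.
Notation "c1 ;; c2" := (Seq c1 c2) (at level 80, right associativity) : program_scope.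
Local Open Scope program_scope.

Definition If_eq e1 e2 c1 c2 := If e1 e2 (If e2 e1 c1 c2) c2.

Lemma run_If_eq e1 e2 c1 c2 s :
  run (If_eq e1 e2 c1 c2) s = if eval s e1 == eval s e2 then run c1 s else run c2 s.
Proof. by rewrite !run_If eq_le; case: ifP. Qed.

Definition var a := Read a (Const 0).
Definition assign a e := Write a (Const 0) e.
Definition incr a := assign a (Add (var a) (Const 1)).

Definition agents := Read 0 (Const 0).
Definition items := Read 0 (Const 1).
(* Cell a of array 5 holds a * m, the machine having no multiplication. *)
Definition value a o := Read 1 (Add (Read 5 a) o).
Definition holder o := Read 2 o.
Definition wealth a := Read 3 a.
(* Label a is stored in cell a past the current offset, which is variable 7;
   increasing the offset by n resets all labels to 0. *)
Definition label a := Read 4 (Add (var 7) a).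
Definition threshold := var 6.
Definition agent := var 8.
Definition other := var 9.
Definition item := var 10.

Definition rows_body :=
  Write 5 (Add agent (Const 1)) (Add (Read 5 agent) items) ;; incr 8.

Definition rows := While (Add agent (Const 1)) agents rows_body.

(** The loops over items and agents are flattened into one with a loop-free body; [phase_body]
    treats its search over agents, receivers and items in the same way. *)
Definition assign_body :=
  If (Add agent (Const 1)) agents
    (If (value (holder item) item) (value agent item) (Write 2 item agent) Skip ;;
     incr 8)
    (Write 3 (holder item) (Add (wealth (holder item)) (value (holder item) item)) ;;
     assign 8 (Const 0) ;; incr 10).

Definition assign_items := While (Add item (Const 1)) items assign_body.

Definition restart := assign 8 (Const 0) ;; assign 9 (Const 0) ;; assign 10 (Const 0).

(** The unit always goes from [agent] to [other], while [e], the new holder of the item, is [other]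
    for a good and [agent] for a chore. *)
Definition transfer_to e :=
  Write 2 item e ;;
  Write 3 agent (Defs.Sub (wealth agent) (Const 1)) ;;
  Write 3 other (Add (wealth other) (Const 1)) ;;
  restart.

Definition next_agent := incr 8 ;; assign 9 (Const 0) ;; assign 10 (Const 0).
Definition next_other := incr 9 ;; assign 10 (Const 0).

Definition raise_label :=
  Write 4 (Add (var 7) agent) (Add (label agent) (Const 1)) ;; restart.

Definition try_transfer :=
  If_eq (label agent) (Add (label other) (Const 1))
    (If_eq (value agent item) (value other item)
       (If_eq (value agent item) (Const 1)
          (If_eq (holder item) agent (transfer_to other) (incr 10))
          (If_eq (value agent item) (Const (-1))
             (If_eq (holder item) other (transfer_to agent) (incr 10))
             (incr 10)))
       (incr 10))
    (incr 10).

Definition phase_body :=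
  If (wealth agent) (Add threshold (Const 1)) next_agent
    (If agents (label agent) next_agent
      (If agents other raise_label
        (If items item next_other try_transfer))).

Definition phase := While (Add agent (Const 1)) agents phase_body.

Definition next_threshold := incr 6 ;; assign 7 (Add (var 7) agents).

Definition phases := While threshold items (restart ;; phase ;; next_threshold).

Definition balance :=
  If agents (Const 0) Skip
    (rows ;; assign 8 (Const 0) ;; assign_items ;;
     assign 6 (Defs.Sub (Defs.Sub (Const 0) items) (Const 1)) ;; phases).

(** * Correctness and running time of the phases *)

Section Correctness.
Variables (n m : nat) (v : valuations n m).
Hypothesis v3 : symmetric_trivalued v.
Hypothesis n_gt0 : (0 < n)%N.
Implicit Types (f : 'I_m -> 'I_n) (h : 'I_n -> nat).

Definition encodes_table (s : memory) :=
  [/\ s 0%N 0 = n%:Z, s 0%N 1 = m%:Z,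
      forall (a : 'I_n) (o : 'I_m), s 1%N ((a * m)%N%:Z + o%:Z) = v a o &
      forall a : 'I_n, s 5%N a%:Z = (a * m)%N%:Z].

Definition encodes f (s : memory) :=
  [/\ encodes_table s, forall o : 'I_m, s 2%N o%:Z = (f o)%:Z &
      forall a : 'I_n, s 3%N a%:Z = utility v f a].

Record phase_state := PhaseState {
  ps_owner : 'I_m -> 'I_n; ps_label : 'I_n -> nat;
  ps_agent : nat; ps_other : nat; ps_item : nat }.

(** The candidates rejected so far by the lexicographic search for a transfer out of agent [i]. *)
Definition scanned f h (i j k : nat) :=
  forall (a b : 'I_n) (o : 'I_m), nat_of_ord a = i ->
    (b < j)%N || (b == j :> nat) && (o < k)%N -> ~~ admissible v f h a b o.

(** [ep_fresh] keeps the cells past the current labels at 0, so that advancing the offset by [n]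
    provides zero labels for the next phase. *)
Record encodes_phase t x (s : memory) : Prop := EncodesPhase {
  ep_owner : encodes (ps_owner x) s;
  ep_label : forall a : 'I_n, s 4%N (s 7%N 0 + a%:Z) = (ps_label x a)%:Z;
  ep_fresh : forall l : nat, s 4%N (s 7%N 0 + n%:Z + l%:Z) = 0;
  ep_threshold : s 6%N 0 = t;
  ep_agent : s 8%N 0 = (ps_agent x)%:Z;
  ep_other : s 9%N 0 = (ps_other x)%:Z;
  ep_item : s 10%N 0 = (ps_item x)%:Z;
  ep_agent_le : (ps_agent x <= n)%N;
  ep_other_le : (ps_other x <= n)%N;
  ep_item_le : (ps_item x <= m)%N;
  ep_inv : phase_invariant v t (ps_owner x) (ps_label x);
  ep_inactive : forall a : 'I_n, (a < ps_agent x)%N ->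
    ~~ active v t (ps_owner x) (ps_label x) a;
  ep_scanned : scanned (ps_owner x) (ps_label x) (ps_agent x) (ps_other x) (ps_item x) }.

(* Lexicographic: potential, then agent, then other agent, then item. *)
Definition phase_measure x : nat :=
  (potential v (ps_owner x) (ps_label x) * (n.+1 * (n.+1 * m.+1)) +
   (n - ps_agent x) * (n.+1 * m.+1) +
   ((n - ps_other x) * m.+1 + (m - ps_item x)))%N.


(** One unit of potential outweighs resetting all three counters, as in a mixed-radix numeral. *)
Lemma phase_measure_lt f' h' x :
  (potential v f' h' < potential v (ps_owner x) (ps_label x))%N ->
  (phase_measure (PhaseState f' h' 0 0 0) < phase_measure x)%N.
Proof.
move=> lt; rewrite /phase_measure /= !subn0.
set X := (n.+1 * (n.+1 * m.+1))%N.
have key: (n * (n.+1 * m.+1) + (n * m.+1 + m) < X)%N.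
  by rewrite /X [X in (_ < X)%N]mulSn [X in (_ < X + _)%N]mulSn; lia.
have: ((potential v f' h').+1 * X <= potential v (ps_owner x) (ps_label x) * X)%N.
  by rewrite leq_mul2r lt orbT.
move=> le; rewrite -[in X in (_ < X)%N]addnA ltn_addr //.
by apply: leq_trans le; rewrite [leqRHS]mulSn -addnA [leqRHS]addnC -addnS leq_add2l.
Qed.

(** Each branch either advances the search or performs a push or a relabelling, which lowers the
    potential and restarts the search. *)
Lemma phase_step t x s : encodes_phase t x s -> (ps_agent x < n)%N ->
  exists2 y, encodes_phase t y (run phase_body s) & (phase_measure y < phase_measure x)%N.
Proof.
case: x => f h i j k [/= [[n_eq m_eq v_eq row_eq] f_eq u_eq] h_eq fresh t_eq i_eq j_eq k_eq].
move=> i_le j_le k_le inv inact scan lt_in.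
have [a i_a] : exists a : 'I_n, i = a by exists (Ordinal lt_in).
subst i.
have wealthE : eval s (wealth agent) = utility v f a by rewrite /= i_eq u_eq.
have labelE : eval s (label agent) = (h a)%:Z by rewrite /= i_eq h_eq.
have next : ~~ active v t f h a -> exists2 y, encodes_phase t y (run next_agent s) &
    (phase_measure y < phase_measure (PhaseState f h a j k))%N.
  move=> na; exists (PhaseState f h a.+1 0 0); last by rewrite /phase_measure /=; nia.
  rewrite /next_agent /incr /assign !run_Seq !run_Write /=.
  split=> //=; rewrite /write /=.
  - by rewrite i_eq; lia.
  - move=> c; rewrite ltnS leq_eqVlt => /orP[/eqP ca|/inact //].
    by rewrite (val_inj ca).
  - by move=> c b o _; rewrite ltn0 andbF.
rewrite /phase_body run_If wealthE [eval s (Add threshold _)]/= t_eq.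
have [le_u|lt_u] := leP (utility v f a) (t + 1).
  by apply: next; rewrite /active ltNge le_u.
rewrite run_If labelE [eval s agents]/= n_eq.
have [le_h|lt_h] := leP n%:Z (h a)%:Z.
  by apply: next; rewrite /active lt_u /= -leqNgt.
have act : active v t f h a by rewrite /active lt_u.
rewrite run_If [eval s agents]/= n_eq [eval s other]/= j_eq.
have [le_j|lt_j] := leP n%:Z j%:Z.
  (* All receivers have been scanned, so relabelling [a] is legitimate. *)
  have no b o : ~~ admissible v f h a b o.
    by apply: scan => //; rewrite (leq_trans (ltn_ord b)).
  exists (PhaseState f (raise h a) 0 0 0); last first.
    exact/phase_measure_lt/potential_raise.
  rewrite /raise_label /restart /assign !run_Seq !run_Write /= i_eq.
  split=> //=; rewrite /write /=.
  - by move=> b; rewrite (inj_eq (addrI _)) eqz_nat val_eqE !h_eq /raise; case: eqP; lia.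
  - by move=> l; case: eqP => // E; have := ltn_ord a; lia.
  - exact: phase_raise.
  - by move=> c b o _; rewrite ltn0 andbF.
rewrite run_If [eval s items]/= m_eq [eval s item]/= k_eq.
have [le_k|lt_k] := leP m%:Z k%:Z.
  exists (PhaseState f h a j.+1 0); last by rewrite /phase_measure /=; nia.
  rewrite /next_other /incr /assign !run_Seq !run_Write /=.
  split=> //=; rewrite /write /=.
  - by rewrite j_eq; lia.
  - move=> c b o ca; rewrite ltn0 andbF orbF ltnS leq_eqVlt => bj.
    apply: scan => //; case/orP: bj => [->|->//].
    by rewrite (leq_trans (ltn_ord o)) // orbT.
have [b j_b] : exists b : 'I_n, j = b by exists (Ordinal lt_j).
have [o k_o] : exists o : 'I_m, k = o by exists (Ordinal lt_k).
subst j k.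
have skip : ~~ admissible v f h a b o -> exists2 y, encodes_phase t y (run (incr 10) s) &
    (phase_measure y < phase_measure (PhaseState f h a b o))%N.
  move=> na; exists (PhaseState f h a b o.+1); last by rewrite /phase_measure /=; nia.
  rewrite /incr /assign !run_Write /=.
  split=> //=; rewrite /write /=.
  - by rewrite k_eq; lia.
  - move=> c d o' ca; rewrite ltnS [(o' <= o)%N]leq_eqVlt andb_orr orbCA.
    case/orP=> [/andP[/eqP db /eqP oo]|]; last exact: scan.
    by rewrite (val_inj ca) (val_inj db) (val_inj oo).
have move_unit e : eval s e = (receiver v a b o)%:Z -> admissible v f h a b o ->
    exists2 y, encodes_phase t y (run (transfer_to e) s) &
    (phase_measure y < phase_measure (PhaseState f h a b o))%N.
  move=> eE adm; have ne := admissible_neq adm; have /andP[_ tr] := adm.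
  exists (PhaseState (push v f a b o) h 0 0 0); last first.
    exact/phase_measure_lt/(potential_push adm (phase_label inv)).
  rewrite /transfer_to /restart /assign !run_Seq !run_Write /= eE.
  split=> //=; rewrite /write /= ?i_eq ?j_eq ?k_eq.
  - split=> //= [o'|c]; rewrite !eqz_nat !val_eqE.
      by rewrite f_eq /push /reassign; case: ifP.
    rewrite !u_eq utility_push // [b == a]eq_sym (negbTE ne).
    have [->|_] := eqVneq c b; first by rewrite eq_sym (negbTE ne); lia.
    by have [->|_] := eqVneq c a; lia.
  - by apply: phase_push.
  - by move=> c d o' _; rewrite ltn0 andbF.
have valueE : eval s (value agent item) = v a o by rewrite /= i_eq k_eq row_eq v_eq.
have value'E : eval s (value other item) = v b o by rewrite /= j_eq k_eq row_eq v_eq.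
have holderE : eval s (holder item) = (f o)%:Z by rewrite /= k_eq f_eq.
have label'E : eval s (Add (label other) (Const 1)) = (h b).+1%:Z.
  by rewrite /= j_eq h_eq; lia.
rewrite /try_transfer !run_If_eq labelE label'E valueE value'E holderE.
rewrite ![eval s (Const _)]/= [eval s agent]/= [eval s other]/= i_eq j_eq !eqz_nat !val_eqE.
case: eqP => [hab|nab]; last by apply: skip; apply/negP => /andP[/eqP].
case: eqP => [vab|nab]; last by apply: skip; apply/negP => /andP[_ /andP[/eqP]].
have adm : admissible v f h a b o =
   (v a o == 1) && (f o == a) || (v a o == -1) && (f o == b).
  by rewrite /admissible /transfer hab vab !eqxx.
case: eqP => [v1|v1].
  case: eqP => fo; first by apply: move_unit; rewrite ?adm ?v1 ?fo ?eqxx //= /receiver v1.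
  by apply: skip; rewrite adm v1 eqxx /=; apply/norP; split=> //; apply/eqP.
case: eqP => [vN1|vN1]; last first.
  by apply: skip; rewrite adm; move/eqP/negbTE: v1 => ->; move/eqP/negbTE: vN1 => ->.
case: eqP => fo.
  by apply: move_unit; rewrite ?adm ?vN1 ?fo ?eqxx //= /receiver vN1.
by apply: skip; rewrite adm vN1 eqxx /=; apply/eqP.
Qed.

Lemma exec_phase t x s : encodes_phase t x s -> exists y s' t',
  [/\ exec phase s s' t', (t' <= phase_measure x * (cost phase_body).+1 + 1)%N,
      encodes_phase t y s' & ps_agent y = n].
Proof.
move=> ex.
have [|y [s' [t' [xs' le ey lt]]]] := exec_while_run (I := encodes_phase t)
    (mu := phase_measure) (e1 := Add agent (Const 1)) (e2 := agents) (c := phase_body) isT _ ex.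
  move=> {ex}x {}s ex le; apply: phase_step (ex) _.
  by move: le; case: ex => -[[/= -> _ _ _] _ _] _ _ _ -> _ _ _ _ _ _ _ _; lia.
exists y, s', t'; split=> //.
by move: lt; case: ey => -[[/= -> _ _ _] _ _] _ _ _ -> _ _ + _ _ _ _ _; lia.
Qed.

(** The ghost counter [x.2] is the number of phases still to run; at 0 the threshold is [m + 1] and
    the loop stops. *)
Definition threshold_of (x : ('I_m -> 'I_n) * nat) : int := m%:Z + 1 - x.2%:Z.

Definition encodes_phases x (s : memory) :=
  [/\ encodes x.1 s, forall l : nat, s 4%N (s 7%N 0 + l%:Z) = 0,
      s 6%N 0 = threshold_of x, maximal v x.1 & bracketed v (threshold_of x) x.1].

(** This is [phase_measure] at zero counters, with the potential replaced by the bound of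
    [potential_bound]. *)
Definition phase_measure_bound (a b : nat) : nat :=
  ((b * a + b.+1 * (a * a)) * (a.+1 * (a.+1 * b.+1)) +
   a * (a.+1 * b.+1) + (a * b.+1 + b))%N.

Definition phase_time (a b : nat) : nat :=
  (cost restart +
   (phase_measure_bound a b * (cost phase_body).+1 + 1 + cost next_threshold))%N.

Lemma phases_step x s : encodes_phases x s -> eval s threshold <= eval s items ->
  exists y s' t, [/\ exec (restart ;; phase ;; next_threshold) s s' t,
    (t <= phase_time n m)%N, encodes_phases y s' & (y.2 < x.2)%N].
Proof.
case: x => f q [/= [[n_eq m_eq v_eq row_eq] f_eq u_eq] fresh t_eq mf bf].
rewrite m_eq t_eq => le.
have [q' qq'] : exists q', q = q'.+1.
  by exists q.-1; move: le; rewrite /threshold_of /=; lia.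
have [t1 x1 le1] := exec_run s (isT : loop_free restart).
have start : encodes_phase (threshold_of (f, q)) (PhaseState f (fun=> 0%N) 0 0 0)
    (run restart s).
  rewrite /restart /assign !run_Seq !run_Write /=.
  split=> //=; rewrite /write //=.
  by move=> l; rewrite -addrA -PoszD fresh.
have [[g h i j k] [s1 [t2 [x2 le2 ey /= i_n]]]] := exec_phase start.
have [t3 x3 le3] := exec_run s1 (isT : loop_free next_threshold).
exists (g, q'), (run next_threshold s1), (t1 + (t2 + t3))%N.
split; last by rewrite qq'.
- by apply: exec_seq x1 _; apply: exec_seq x2 x3.
- rewrite /phase_time !leq_add //; apply: leq_trans le2 _.
  rewrite leq_add2r leq_mul2r /phase_measure /= !subn0 leq_add2r leq_add2r leq_mul2r.
  by rewrite potential_bound ?orbT.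
- case: ey => /= -[[n_eq' m_eq' v_eq' row_eq'] f_eq' u_eq'] _ fresh' t_eq' _ _ _ _ _ _ inv inact _.
  have te : threshold_of (g, q') = threshold_of (f, q) + 1.
    by rewrite /threshold_of qq' /=; lia.
  rewrite /next_threshold /incr /assign !run_Seq !run_Write /=.
  rewrite /encodes_phases te; split=> //=; rewrite /write //=.
  + by rewrite n_eq'.
  + by rewrite t_eq'.
  + exact: phase_maximal inv.
  + by apply: (phase_end v3 inv) => a; apply: inact; rewrite i_n.
Qed.

Lemma exec_phases f s : encodes_phases (f, (2 * m).+2) s -> exists g s' t,
  [/\ exec phases s s' t, (t <= (2 * m).+2 * (phase_time n m).+1 + 1)%N,
      encodes g s', maximal v g & bracketed v (m%:Z + 1) g].
Proof.
move=> ef; have [[g q] [s' [t [xs' le eg lt]]]] := exec_while phases_step ef.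
exists g, s', t; move: lt; case: eg => eg _ /= -> mg.
rewrite /threshold_of /=; case: (eg) => -[_ -> _ _] _ _ bg lt.
have q0 : q = 0%N by lia.
by move: bg; rewrite q0 subr0.
Qed.

(** * Row offsets, the initial maximal assignment and the whole program *)

Definition encodes_rows i (s : memory) :=
  [/\ (i <= n)%N, forall l, (l <= i)%N -> s 5%N l%:Z = (l * m)%N%:Z,
      s 8%N 0 = i%:Z &
      forall a l, a \notin [:: 5; 8]%N -> s a l = input_memory v a l].

Lemma rows_step i s : encodes_rows i s -> eval s (Add agent (Const 1)) <= eval s agents ->
  exists2 j, encodes_rows j (run rows_body s) & (n - j < n - i)%N.
Proof.
move=> [i_le row_eq i_eq same]; rewrite /= i_eq same //= => lt.
exists i.+1; last by lia.
rewrite /rows_body /incr /assign !run_Seq !run_Write /= i_eq row_eq // same //=.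
split=> //=; rewrite /write //=.
- by lia.
- move=> l; rewrite leq_eqVlt => /orP[/eqP ->|li].
    have -> : (i.+1%:Z == i%:Z + 1) = true by lia.
    by rewrite mulSn; lia.
  by rewrite row_eq // ifF //; lia.
- by rewrite i_eq; lia.
- move=> a l; rewrite !inE negb_or => /andP[/negbTE a5 /negbTE a8].
  by rewrite a5 a8 /= same // !inE a5 a8.
Qed.

Lemma exec_rows : exists s t,
  [/\ exec rows (input_memory v) s t, (t <= n * (cost rows_body).+1 + 1)%N &
      encodes_rows n s].
Proof.
have e0 : encodes_rows 0 (input_memory v).
  by split=> // l; rewrite leqn0 => /eqP ->.
have [i [s [t [xs le [i_le row_eq i_eq same] lt]]]] :=
  exec_while_run (c := rows_body) isT rows_step e0.
exists s, t; rewrite subn0 in le; split=> //.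
suff -> : n = i by split=> //; lia.
by move: lt; rewrite /= i_eq same //=; lia.
Qed.

Record assign_state := AssignState {
  as_owner : 'I_m -> 'I_n; as_agent : nat; as_item : nat }.

(** Wealth counts finished items only, because the holder of the current item may still change. *)
Record encodes_assign x (s : memory) : Prop := EncodesAssign {
  ea_table : encodes_table s;
  ea_owner : forall o : 'I_m, s 2%N o%:Z = (as_owner x o)%:Z;
  ea_wealth : forall a : 'I_n, s 3%N a%:Z =
    \sum_o (if (as_owner x o == a) && (o < as_item x)%N then v a o else 0);
  ea_label : forall l, s 4%N l = 0;
  ea_agent : s 8%N 0 = (as_agent x)%:Z;
  ea_item : s 10%N 0 = (as_item x)%:Z;
  ea_agent_le : (as_agent x <= n)%N;
  ea_item_le : (as_item x <= m)%N;
  ea_max : forall (a : 'I_n) (o : 'I_m),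
    (o < as_item x)%N || (o == as_item x :> nat) && (a < as_agent x)%N ->
    v a o <= v (as_owner x o) o }.

Definition assign_measure x : nat := ((m - as_item x) * n.+1 + (n - as_agent x))%N.

Lemma assign_step x s : encodes_assign x s ->
  eval s (Add item (Const 1)) <= eval s items ->
  exists2 y, encodes_assign y (run assign_body s) & (assign_measure y < assign_measure x)%N.
Proof.
case: x => f i k [/= [n_eq m_eq v_eq row_eq] f_eq u_eq z_eq i_eq k_eq i_le k_le fmax].
rewrite k_eq m_eq => lt.
have [o k_o] : exists o : 'I_m, k = o.
  have lt_k : (k < m)%N by lia.
  by exists (Ordinal lt_k).
subst k => {lt}.
have valueE : eval s (value (holder item) item) = v (f o) o.
  by rewrite /= k_eq f_eq row_eq v_eq.
rewrite /assign_body run_If [eval s (Add _ _)]/= [eval s agents]/= i_eq n_eq.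
have [lt_i|le_n] := leP.
  have [a i_a] : exists a : 'I_n, i = a.
    have lt_in : (i < n)%N by lia.
    by exists (Ordinal lt_in).
  subst i; rewrite run_Seq run_If valueE.
  have -> : eval s (value agent item) = v a o by rewrite /= i_eq k_eq row_eq v_eq.
  have meas g : (assign_measure (AssignState g a.+1 o) < assign_measure (AssignState f a o))%N.
    by rewrite /assign_measure /=; have := ltn_ord a; lia.
  case: ifP => [le|/negbT nle].
    exists (AssignState (reassign f o a) a.+1 o) => //.
    rewrite /incr /assign !run_Write /=.
    split=> //=; rewrite /write /=.
    - move=> o'; rewrite k_eq i_eq eqz_nat val_eqE f_eq /reassign.
      by case: ifP.
    - move=> b; rewrite u_eq; apply: eq_bigr => o' _; rewrite /reassign.
      by case: (o' =P o) => [->|//]; rewrite ltnn !andbF.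
    - by rewrite i_eq; lia.
    - move=> b o'; rewrite /reassign; have [->|ne] := eqVneq o' o.
        rewrite ltnn eqxx /= ltnS leq_eqVlt => /orP[/eqP/val_inj -> //|lt_b].
        by apply: le_trans le; apply: fmax; rewrite eqxx lt_b orbT.
      rewrite val_eqE (negbTE ne) /= orbF => lt_o.
      by apply: fmax; rewrite lt_o.
  exists (AssignState f a.+1 o) => //.
  rewrite /incr /assign run_Skip !run_Write /=.
  split=> //=; rewrite /write /=.
  - by rewrite i_eq; lia.
  - move=> b o' /orP[lt_o|/andP[eq_o]]; first by apply: fmax; rewrite lt_o.
    rewrite ltnS leq_eqVlt => /orP[/eqP/val_inj ->|lt_b].
      by rewrite (val_inj (eqP eq_o)); move: nle; rewrite -ltNge => /ltW.
    by apply: fmax; rewrite eq_o lt_b orbT.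
exists (AssignState f 0 o.+1); last first.
  by rewrite /assign_measure /=; have := ltn_ord o; nia.
rewrite /incr /assign !run_Seq !run_Write.
have -> : eval s (Add (wealth (holder item)) (value (holder item) item)) =
    s 3%N (f o)%:Z + v (f o) o by rewrite -valueE /= k_eq f_eq.
rewrite /= k_eq f_eq.
split=> //=; rewrite /write /=.
- move=> a; rewrite eqz_nat val_eqE !u_eq.
  have rest b : \sum_o' (if (f o' == b) && (o' < o)%N then v b o' else 0) =
      \sum_(o' | o' != o) (if (f o' == b) && (o' < o.+1)%N then v b o' else 0).
    rewrite (bigD1 o) //= ltnn andbF add0r; apply: eq_bigr => o' ne.
    by rewrite ltnS [(o' <= o)%N]leq_eqVlt val_eqE (negbTE ne).
  rewrite !rest [RHS](bigD1 o) //= ltnSn andbT.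
  have [->|ne] := eqVneq a (f o); first by rewrite addrC.
  by rewrite add0r.
- by rewrite k_eq; lia.
- move=> a o'; rewrite ltn0 andbF orbF ltnS leq_eqVlt => /orP[eq_o|lt_o].
    (* The finished item has been compared for all [n] agents. *)
    by apply: fmax; rewrite eq_o orbC (leq_trans (ltn_ord a)) //; lia.
  by apply: fmax; rewrite lt_o.
Qed.

Lemma exec_assign_items f s : encodes_assign (AssignState f 0 0) s ->
  exists g s' t, [/\ exec assign_items s s' t,
    (t <= (m * n.+1 + n) * (cost assign_body).+1 + 1)%N,
    encodes g s', maximal v g & forall l, s' 4%N l = 0].
Proof.
move=> ef; have [[g i k] [s' [t [xs' le eg lt]]]] :=
  exec_while_run (c := assign_body) isT assign_step ef.
rewrite /assign_measure /= !subn0 in le.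
exists g, s', t; case: eg lt => -[n_eq m_eq v_eq row_eq] /= f_eq u_eq z_eq _ k_eq _ k_le gmax.
rewrite k_eq m_eq => lt; have {lt k_le k_eq} km : k = m by lia.
subst k; split=> //.
- split=> // a; rewrite u_eq -big_mkcond; apply: eq_bigl => o.
  by rewrite ltn_ord andbT.
- by move=> a o; apply: gmax; rewrite ltn_ord.
Qed.

Definition balance_time (a b : nat) : nat :=
  ((a * (cost rows_body).+1 + 1) +
   (1 + ((b * a.+1 + a) * (cost assign_body).+1 + 1 +
         (1 + ((2 * b).+2 * (phase_time a b).+1 + 1)))))%N.+1.

Lemma exec_balance : exists f s t,
  [/\ exec balance (input_memory v) s t, (t <= balance_time n m)%N,
      encodes f s, maximal v f & bracketed v (m%:Z + 1) f].
Proof.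
have [s1 [t1 [x1 le1 [_ row_eq i_eq same]]]] := exec_rows.
pose s2 := write s1 8 0 0.
(* Array 2 is initially 0, so every item starts with agent 0. *)
have e2 : encodes_assign (AssignState (fun=> Ordinal n_gt0) 0 0) s2.
  split=> //=; rewrite /s2 /write //=.
  - split=> //=; try by rewrite same.
      by move=> a o; rewrite same // -PoszD input_memory_table.
    by move=> a; apply: row_eq; apply: ltnW.
  - by move=> o; rewrite same.
  - by move=> a; rewrite same // big1 // => o _; rewrite andbF.
  - by move=> l; rewrite same.
  - by rewrite same.
  - by move=> a o; rewrite !ltn0 andbF.
have [f [s3 [t3 [x3 le3 [e_tab f_eq u_eq] mf z_eq]]]] := exec_assign_items e2.
pose s4 := write s3 6 0 (eval s3 (Defs.Sub (Defs.Sub (Const 0) items) (Const 1))).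
(* The thresholds run from [-m - 1] to [m], which makes [2 * m + 2] phases. *)
have e4 : encodes_phases (f, (2 * m).+2) s4.
  have te : threshold_of (f, (2 * m).+2) = - m%:Z - 1 by rewrite /threshold_of /=; lia.
  split; rewrite ?te //.
  - by move=> l; apply: z_eq.
  - by case: e_tab => _ m_eq _ _; rewrite /s4 /write /= m_eq sub0r.
  - exact: bracketed_start.
have [g [s5 [t5 [x5 le5 eg mg bg]]]] := exec_phases e4.
exists g, s5, (t1 + (1 + (t3 + (1 + t5)))).+1; split=> //.
  apply: exec_if_false; first by rewrite /= ltz_nat.
  apply: exec_seq x1 _; apply: exec_seq (exec_write _ _ _ _) _.
  by apply: exec_seq x3 _; apply: exec_seq (exec_write _ _ _ _) _; exact: x5.
by rewrite /balance_time ltnS !leq_add.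
Qed.

End Correctness.

(** * Reading the answer and the polynomial time bound *)

Lemma output_owner n m (v : valuations n m) f s : encodes v f s -> owner f (output n m s).
Proof. by case=> _ f_eq _ a o; rewrite inE f_eq eqz_nat val_eqE. Qed.

Lemma balance_time_mono a b c : (a <= c)%N -> (b <= c)%N ->
  (balance_time a b <= balance_time c c)%N.
Proof.
move=> ac bc; rewrite /balance_time /phase_time /phase_measure_bound.
by repeat first [ exact: leqnn | exact: ac | exact: bc | rewrite ltnS
  | apply: leq_add | apply: leq_mul ].
Qed.

Definition balance_poly : {poly nat} :=
  let one := 1%:P in
  let X1 := one + 'X in
  let D := X1 * X1 in
  let M := ('X * 'X + X1 * ('X * 'X)) * (X1 * D) + 'X * D + ('X * X1 + 'X) in
  let P := (cost restart)%:P +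
           (M * (cost phase_body).+1%:P + one + (cost next_threshold)%:P) in
  one + (('X * (cost rows_body).+1%:P + one) +
         (one + (('X * X1 + 'X) * (cost assign_body).+1%:P + one +
                 (one + ((2%:P + 2%:P * 'X) * (one + P) + one))))).

Lemma horner_balance_poly c : balance_poly.[c] = balance_time c c.
Proof.
rewrite /balance_poly /balance_time /phase_time /phase_measure_bound.
move: (cost _) (cost _) (cost _) (cost _) (cost _) => c1 c2 c3 c4 c5.
by rewrite !(hornerD, hornerM, hornerC, hornerX).
Qed.

(** Without agents the union of the bundles is empty, so an allocation exists only if there are no
    items; all remaining conditions quantify over agents. *)
Lemma no_agents m (v : valuations 0 m) (B : bundles 0 m) :
  (exists A : bundles 0 m, [/\ allocation A, EQ1 v A & PO v A]) ->
  [/\ allocation B, EQ1 v B & PO v B].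
Proof.
case=> A [[_ cA] _ _]; split=> [|[]//|[A' [_ _ [[]//]]]].
by split=> [[]//|]; rewrite big_ord0 -cA big_ord0.
Qed.

Theorem theorem5p3 :
  exists (c : program) (p : {poly nat}),
    forall (n m : nat) (v : valuations n m),
      symmetric_trivalued v ->
      exists (s : memory) (t : nat),
        [/\ exec c (input_memory v) s t,
            (t <= p.[(n + m)%N])%N &
            (exists A : bundles n m, [/\ allocation A, EQ1 v A & PO v A]) ->
            [/\ allocation (output n m s), EQ1 v (output n m s)
              & PO v (output n m s)]].
Proof.
exists balance, balance_poly => n m v v3.
rewrite horner_balance_poly.
have [n0|n0] := posnP n.
  subst n; exists (input_memory v), 2%N; split=> //; last exact: no_agents.
    by apply: exec_if_true => //; apply: exec_skip.
  by rewrite /balance_time addn1 addSn.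
have [f [s [t [xs le ef mf bf]]]] := exec_balance v3 n0.
exists s, t; split=> //.
  by apply: leq_trans le _; apply: balance_time_mono; rewrite ?leq_addr ?leq_addl.
(* The run does not depend on [k]: the bracketing holds for all feasible bounds at once. *)
case=> A [aA eA pA]; have [k fk] := EQ1_PO_feasible v3 n0 aA eA pA.
apply: balanced_EQ1_PO (output_owner ef) mf _ => //.
exact: bracketed_balanced bf fk.
Qed.
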